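(* Let $X$ be a reflexive real Banach space and $Y$ an arbitrary real Banach space. Suppose $Z$ is a closed subspace of $Y$. Let $T\in\mathcal{K}(X,Y)$ be a multi-smooth operator of finite order with $M_T\cap E_X=\{\pm x_i\in S_X:1\le i\le n\}$, where $\{x_1,x_2,\dots,x_n\}$ is linearly independent. Suppose that $T\perp_B\mathcal{L}(X,Z)$. Then there exists $x_0\in M_T\cap E_X$ such that the following hold. (i) $d(T,\mathcal{L}(X,Z))=\sup_{x\in S_X}d(Tx,Z)=d(Tx_0,Z)$. (ii) $Tx_0\perp_B Z^{\perp\perp}$. (iii) $T\perp_B\mathcal{L}(X,Z^{\perp\perp})$.
   Context: All Banach spaces are real, and every Banach space is regarded as canonically embedded in its bidual. $\mathcal{L}(X,Y)$ (respectively $\mathcal{K}(X,Y)$) is the space of bounded (respectively compact) linear operators with the operator norm; for a subspace $Z\subset Y$, $\mathcal{L}(X,Z)$ is regarded as a subspace of $\mathcal{L}(X,Y)$. $S_X$, $B_X$ are the unit sphere and closed unit ball of $X$; $E_X$ is the set of extreme points of $B_X$. $M_T=\{x\in S_X:\|Tx\|=\|T\|\}$. For a subspace $W$ of a normed space $V$ and $v\in V$, $d(v,W)=\inf_{w\in W}\|v-w\|$. Birkhoff-James orthogonality: $v\perp_B w$ means $\|v+\lambda w\|\ge\|v\|$ for all scalars $\lambda$; $v\perp_B W$ means $v\perp_B w$ for all $w\in W$. $Z^\perp=\{y^*\in Y^*:y^*(z)=0\ \forall z\in Z\}$ and $Z^{\perp\perp}\subset Y^{**}$ is the annihilator of $Z^\perp$.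 In (ii), $Tx_0$ is viewed in $Y^{**}$; in (iii), $T$ is viewed as an element of $\mathcal{L}(X,Y^{**})$, of which $\mathcal{L}(X,Z^{\perp\perp})$ is a subspace. A non-zero $T\in\mathcal{L}(X,Y)$ is a multi-smooth operator of finite order if the linear span of $J(T)=\{f\in S_{\mathcal{L}(X,Y)^*}:f(T)=\|T\|\}$ is finite-dimensional. *)

(* Defs.v *)
From HB Require Import structures.
From mathcomp Require Import all_boot all_order all_algebra.
From mathcomp Require Import all_classical all_reals all_analysis.

Set Implicit Arguments.
Unset Strict Implicit.
Unset Printing Implicit Defensive.

Import Order.TTheory GRing.Theory Num.Theory.
Import numFieldNormedType.Exports.

Local Open Scope classical_set_scope.
Local Open Scope ring_scope.

Section bounded_operators.
Context {R : realType}.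
Implicit Types X Y : normedModType R.

Definition bounded_linear X Y : {pred X -> Y} :=
  [pred f | `[< linear f /\ exists M : R, forall x, `|f x| <= M * `|x| >]].
Arguments bounded_linear : clear implicits.

Record bop X Y := Bop {
  bop_fun :> X -> Y ;
  bop_funP : bop_fun \in bounded_linear X Y }.

HB.instance Definition _ X Y := [isSub for @bop_fun X Y].
HB.instance Definition _ X Y := [Choice of bop X Y by <:].

Lemma bounded_linear_submod_closed X Y : submod_closed (bounded_linear X Y).
Proof.
split.
  apply/asboolP; split; first by move=> a u v; rewrite scaler0 addr0.
  by exists 0 => x; rewrite normr0 mul0r.
move=> a f g /asboolP[lf [M Mf]] /asboolP[lg [N Ng]].
apply/asboolP; split.
  move=> b u v; rewrite [LHS]/(a *: f (b *: u + v) + g (b *: u + v)).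
  rewrite [RHS]/(b *: (a *: f u + g u) + (a *: f v + g v)).
  by rewrite lf lg !scalerDr !scalerA (mulrC a b); exact: addrACA.
exists (`|a| * M + N) => x; rewrite [X in `|X|]/(a *: f x + g x) mulrDl -mulrA.
rewrite (le_trans (ler_normD _ _))// lerD// normrZ.
by rewrite ler_wpM2l.
Qed.

HB.instance Definition _ X Y :=
  GRing.isSubmodClosed.Build R (X -> Y) (bounded_linear X Y)
    (@bounded_linear_submod_closed X Y).
HB.instance Definition _ X Y := [SubChoice_isSubLmodule of bop X Y by <:].

Lemma bop_linear X Y (T : bop X Y) : linear T.
Proof. by have /asboolP[] := bop_funP T. Qed.

HB.instance Definition _ X Y (T : bop X Y) :=
  GRing.isLinear.Build R X Y *:%R T (bop_linear T).

Lemma bop_bounded X Y (T : bop X Y) :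
  exists M : R, forall x, `|T x| <= M * `|x|.
Proof. by have /asboolP[] := bop_funP T. Qed.

Lemma bopD X Y (S T : bop X Y) x : (S + T) x = S x + T x.
Proof. by []. Qed.

Lemma bopZ X Y (a : R) (T : bop X Y) x : (a *: T) x = a *: T x.
Proof. by []. Qed.

Lemma bop_ext X Y (S T : bop X Y) : S =1 T -> S = T.
Proof. by move=> ST; apply/val_inj/funext. Qed.

Definition unit_ball X : set X := [set x | `|x| <= 1].
Definition unit_sphere X : set X := [set x | `|x| = 1].
Arguments unit_ball : clear implicits.
Arguments unit_sphere : clear implicits.

Definition opnorm X Y (T : bop X Y) : R :=
  sup [set `|T x| | x in unit_ball X].

Lemma opnorm_has_sup X Y (T : bop X Y) :
  has_sup [set `|T x| | x in unit_ball X].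
Proof.
split; first by exists `|T 0|, 0 => //=; rewrite /unit_ball/= normr0.
have [M TM] := bop_bounded T.
exists `|M| => _ [x /= x1 <-]; rewrite (le_trans (TM x))//.
by rewrite (le_trans (ler_norm _))// normrM normr_id ler_piMr.
Qed.

Lemma opnorm_ge0 X Y (T : bop X Y) : 0 <= opnorm T.
Proof.
apply: (@le_trans _ _ `|T 0|) => //.
apply: (sup_upper_bound (opnorm_has_sup T)).
by exists 0 => //; rewrite /unit_ball/= normr0.
Qed.

Lemma le_opnorm X Y (T : bop X Y) x : `|T x| <= opnorm T * `|x|.
Proof.
have [->|x0] := eqVneq x 0; first by rewrite raddf0 !normr0 mulr0.
have nx : 0 < `|x| by rewrite normr_gt0.
rewrite -ler_pdivrMr// mulrC -[`|x|^-1]ger0_norm ?invr_ge0//.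
rewrite -normrZ -linearZ/=; apply: (sup_upper_bound (opnorm_has_sup T)).
exists (`|x|^-1 *: x) => //; rewrite /unit_ball/= normrZ ger0_norm ?invr_ge0//.
by rewrite mulVf ?gt_eqF.
Qed.

Lemma opnorm_le X Y (T : bop X Y) (M : R) :
  0 <= M -> (forall x, `|T x| <= M * `|x|) -> opnorm T <= M.
Proof.
move=> M0 TM; apply: ge_sup; first exact: (opnorm_has_sup T).1.
by move=> _ [x /= x1 <-]; rewrite (le_trans (TM x))// ler_piMr.
Qed.

Lemma opnormD X Y (S T : bop X Y) : opnorm (S + T) <= opnorm S + opnorm T.
Proof.
apply: opnorm_le; first by rewrite addr_ge0// opnorm_ge0.
move=> x; rewrite bopD (le_trans (ler_normD _ _))// mulrDl.
by rewrite lerD// le_opnorm.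
Qed.

Lemma opnormZ X Y (a : R) (T : bop X Y) : opnorm (a *: T) = `|a| * opnorm T.
Proof.
have le b (S : bop X Y) : opnorm (b *: S) <= `|b| * opnorm S.
  apply: opnorm_le; first by rewrite mulr_ge0// opnorm_ge0.
  by move=> x; rewrite bopZ normrZ -mulrA ler_wpM2l// le_opnorm.
apply/eqP; rewrite eq_le le/=.
have [->|a0] := eqVneq a 0; first by rewrite normr0 mul0r opnorm_ge0.
rewrite -ler_pdivlMl ?normr_gt0// -normfV.
by rewrite -{1}[T]scale1r -(mulVf a0) -scalerA le.
Qed.

Lemma opnorm_eq0 X Y (T : bop X Y) : opnorm T = 0 -> T = 0.
Proof.
move=> T0; apply: bop_ext => x; apply/eqP; rewrite -normr_le0.
by rewrite (le_trans (le_opnorm T x))// T0 mul0r.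
Qed.

HB.instance Definition _ X Y := Lmodule_isNormed.Build R (bop X Y)
  (@opnormD X Y) (@opnormZ X Y) (@opnorm_eq0 X Y).

Lemma bop_normE X Y (T : bop X Y) :
  `|T| = sup [set `|T x| | x in unit_ball X].
Proof. by []. Qed.

Lemma bop_le_norm X Y (T : bop X Y) x : `|T x| <= `|T| * `|x|.
Proof. exact: le_opnorm. Qed.

Lemma bop_continuous X Y (T : bop X Y) : continuous T.
Proof.
apply: bounded_linear_continuous; apply/linear_boundedP.
near=> r => x; apply: (le_trans (le_opnorm T x)); apply: ler_wpM2r => //.
Unshelve. all: by end_near. Qed.

Lemma bop_comp_subproof X Y Z (S : bop Y Z) (T : bop X Y) :
  S \o T \in bounded_linear X Z.
Proof.
apply/asboolP; split; first by move=> a u v /=; rewrite !linearP.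
exists (opnorm S * opnorm T) => x /=; rewrite (le_trans (le_opnorm _ _))//.
by rewrite -mulrA ler_wpM2l ?opnorm_ge0// le_opnorm.
Qed.

Definition bop_comp X Y Z (S : bop Y Z) (T : bop X Y) : bop X Z :=
  Bop (bop_comp_subproof S T).

End bounded_operators.
Arguments bounded_linear {R} X Y.
Arguments unit_ball {R} X.
Arguments unit_sphere {R} X.

Notation dual X := (bop X (GRing.regular _)).
Notation bidual X := (dual (dual X)).

Section canonical_embedding.
Context {R : realType} (X : normedModType R).

Lemma eval_at_subproof (x : X) :
  (fun f : dual X => f x) \in bounded_linear (dual X) R^o.
Proof.
apply/asboolP; split; first by [].
by exists `|x| => f; rewrite [leRHS]mulrC; exact: bop_le_norm.
Qed.

Definition eval_at (x : X) : bidual X := Bop (eval_at_subproof x).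

Lemma bidual_emb_subproof : eval_at \in bounded_linear X (bidual X).
Proof.
apply/asboolP; split.
  by move=> a u v; apply: bop_ext => f; exact: linearP.
exists 1 => x; rewrite mul1r; apply: opnorm_le => // f.
by rewrite [leRHS]mulrC; exact: (bop_le_norm f x).
Qed.

Definition bidual_emb : bop X (bidual X) := Bop bidual_emb_subproof.

Definition reflexive_space : Prop := range bidual_emb = setT.

End canonical_embedding.
Arguments bidual_emb {R} X.

Section general_notions.
Context {R : realType} (V : normedModType R).
Implicit Types (v w : V) (A W : set V).

Definition linear_subspace W : Prop :=
  W 0 /\ forall (a : R) v w, W v -> W w -> W (a *: v + w).

Definition dist v W : R := inf [set `|v - w| | w in W].

Definition bj_orth v w : Prop := forall a : R, `|v| <= `|v + a *: w|.

Definition bj_orth_set v W : Prop := forall w, W w -> bj_orth v w.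

Definition annihilator W : set (dual V) :=
  [set f : dual V | forall w, W w -> f w = 0].

Definition extreme_points A : set V :=
  [set x | A x /\ forall u v (t : R), A u -> A v -> 0 < t < 1 ->
     x = t *: u + (1 - t) *: v -> u = x /\ v = x].

Definition lin_indep n (x : 'I_n -> V) : Prop :=
  forall a : 'I_n -> R, \sum_(i < n) a i *: x i = 0 -> forall i, a i = 0.

Definition lin_span A : set V :=
  [set v | exists (n : nat) (a : 'I_n -> R) (u : 'I_n -> V),
     (forall i, A (u i)) /\ v = \sum_(i < n) a i *: u i].

Definition finite_dimensional W : Prop :=
  exists (n : nat) (b : 'I_n -> V), W = lin_span (range b).

(* J(v); for v an operator T : bop X Y these live in the dual of the whole
   space bop X Y, not only of the compact operators. *)
Definition support_functionals v : set (dual V) :=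
  [set f : dual V | `|f| = 1 /\ f v = `|v|].

End general_notions.

Section operator_notions.
Context {R : realType} {X Y : normedModType R}.

Definition compact_operator (T : bop X Y) : Prop :=
  precompact (T @` unit_ball X).

Definition norm_attainment (T : bop X Y) : set X :=
  [set x | unit_sphere X x /\ `|T x| = `|T|].

(* L(X, Z) as a subspace of L(X, Y). *)
Definition ops_into (Z : set Y) : set (bop X Y) :=
  [set S | forall x, Z (S x)].

Definition multi_smooth_finite_order (T : bop X Y) : Prop :=
  T <> 0 /\ finite_dimensional (lin_span (support_functionals T)).

End operator_notions.

(* Main.v *)
Require Import Defs.
From mathcomp Require Import all_boot all_order all_algebra.
From mathcomp Require Import all_classical all_reals all_analysis.
From mathcomp Require Import lra.
Import numFieldNormedType.Exports.
Import Order.TTheory GRing.Theory Num.Theory.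

(** The theorem reduces to finding an extreme norm-attaining point [x i] with
    [T (x i)] Birkhoff-James orthogonal to [Z] ([bj_orth_at_extreme_point]).
    Given such a point, [dist (T (x i)) Z = `|T|], which is also an upper bound of
    every [dist (T y) Z] on the sphere and, by hypothesis, the distance of [T] to
    the operators into [Z]; this is (i). A functional [g] of norm at most one that
    vanishes on [Z] and norms [T (x i)] ([bj_orth_functional]) is killed by every
    element of the second annihilator of [Z], so evaluation at [g] bounds the
    norms in (ii) and (iii) from below by [`|T|].

    To find the point, suppose that each [T (x i)] can be shortened to
    [T (x i) + z i] with [z i] in [Z]. Biorthogonal functionals of the [x i] give
    an operator [S] of finite rank into [Z] that maps [x i] to [z i]. Since [T] is
    orthogonal to [S], a compactness argument ([bj_orth_norming_pair]) produces
    [u] in the unit ball and [g] in the dual ball with [g (T u) = `|T|] and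
    [0 <= g (S u)]. The points of the ball where [g \o T] is maximal form a weakly
    closed face, and so do those among them where [g \o S] is maximal; a face
    contains an extreme point of the ball ([weak_face_extreme_point]). Hence
    [u] may be taken extreme, that is, equal to some [x i] or [- x i], and there
    [`|T| <= g (T u + S u) <= `|T (x i) + z i| < `|T|], a contradiction.

    The tools from functional analysis are developed on the way: the Hahn-Banach
    theorem through minimal sublinear functionals, and the weak compactness of
    the ball of a reflexive space through convergence along ultrafilters. *)

Set Implicit Arguments.
Unset Strict Implicit.
Unset Printing Implicit Defensive.

Local Open Scope classical_set_scope.
Local Open Scope ring_scope.

(** * The Hahn-Banach theorem for sublinear functionals *)

Section sublinear_functionals.
Context {R : realType} {V : lmodType R}.
Implicit Types p q : V -> R.

Definition sublinear p : Prop :=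
  (forall x y, p (x + y) <= p x + p y) /\
  (forall (a : R) x, 0 <= a -> p (a *: x) <= a * p x).

Lemma sublinear0 p : sublinear p -> p 0 = 0.
Proof.
move=> [pD pZ]; apply/eqP; rewrite eq_le; apply/andP; split.
  by have := pZ 0 0 (lexx 0); rewrite scale0r mul0r.
by have := pD 0 0; rewrite addr0 -[leLHS]addr0 lerD2l.
Qed.

Lemma sublinear_geN p x : sublinear p -> - p (- x) <= p x.
Proof.
move=> sp; rewrite -subr_ge0 opprK -(sublinear0 sp) -(subrr x).
exact: sp.1.
Qed.

Lemma sublinear_ray p (a : R) x :
  sublinear p -> 0 <= a -> a * p x <= p (a *: x).
Proof.
move=> sp; rewrite le_eqVlt => /predU1P[<-|a0].
  by rewrite scale0r mul0r sublinear0.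
rewrite -ler_pdivlMl// -{1}[x]scale1r -(mulVf (lt0r_neq0 a0)) -scalerA.
by apply: sp.2; rewrite invr_ge0 ltW.
Qed.

Definition ray_values p (v x : V) : set R :=
  [set p (x + a *: v) - a * p v | a in [set a : R | 0 <= a]].

(** A sublinear functional below [p] whose value at [- v] is at most [- p v]:
    a minimal sublinear functional cannot be lowered this way, so it has to be
    odd, and an odd sublinear functional is linear. *)
Definition tilt p (v x : V) : R := inf (ray_values p v x).

Lemma ray_values_has_inf p v x : sublinear p -> has_inf (ray_values p v x).
Proof.
move=> sp; split; first by exists (p (x + 0 *: v) - 0 * p v), 0 => //=.
exists (- p (- x)) => _ [a /= a0 <-].
rewrite lerBrDr addrC lerBlDr (le_trans (sublinear_ray v sp a0))//.
by have := sp.1 (x + a *: v) (- x); rewrite addrAC subrr add0r.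
Qed.

Lemma tilt_le p v x (a : R) :
  sublinear p -> 0 <= a -> tilt p v x <= p (x + a *: v) - a * p v.
Proof.
move=> sp a0; apply: (ge_inf (ray_values_has_inf v x sp).2).
by exists a.
Qed.

Lemma le_tilt p v x (m : R) :
  (forall a, 0 <= a -> m <= p (x + a *: v) - a * p v) -> m <= tilt p v x.
Proof.
move=> mp; apply: lb_le_inf; first by exists (p (x + 0 *: v) - 0 * p v), 0 => //=.
by move=> _ [a /= a0 <-]; exact: mp.
Qed.

Lemma tilt_below p v x : sublinear p -> tilt p v x <= p x.
Proof.
by move=> sp; have := tilt_le v x sp (lexx 0); rewrite scale0r mul0r addr0 subr0.
Qed.

Lemma sublinear_tilt p v : sublinear p -> sublinear (tilt p v).
Proof.
move=> sp; split.
  move=> x y; rewrite -lerBlDr; apply: le_tilt => a a0.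
  rewrite lerBlDr -lerBlDl; apply: le_tilt => b b0; rewrite lerBlDl.
  rewrite (le_trans (tilt_le v (x + y) sp (addr_ge0 a0 b0)))//.
  by rewrite scalerDl addrACA mulrDl opprD [leRHS]addrACA lerD2r; exact: sp.1.
move=> a x; rewrite le_eqVlt => /predU1P[<-|a0].
  by rewrite scale0r mul0r (le_trans (tilt_below v 0 sp))// sublinear0.
rewrite -ler_pdivrMl//; apply: le_tilt => b b0.
rewrite ler_pdivrMl//.
apply: (le_trans (tilt_le v (a *: x) sp (mulr_ge0 (ltW a0) b0))).
by rewrite -scalerA -scalerDr mulrBr -mulrA lerB//; apply: sp.2; exact: ltW.
Qed.

Lemma tiltN p v : sublinear p -> tilt p v (- v) <= - p v.
Proof.
move=> sp; rewrite (le_trans (tilt_le v (- v) sp ler01))//.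
by rewrite scale1r addNr sublinear0// mul1r sub0r.
Qed.

Lemma minimal_sublinear_linear p : sublinear p ->
  (forall q, sublinear q -> (forall x, q x <= p x) -> forall x, p x <= q x) ->
  linear (p : V -> R^o).
Proof.
move=> sp pmin.
have pN x : p (- x) = - p x.
  apply/eqP; rewrite eq_le; apply/andP; split.
    apply: le_trans (tiltN x sp).
    apply: pmin; [exact: sublinear_tilt|].
    by move=> y; exact: tilt_below.
  by rewrite lerNl; exact: sublinear_geN.
have pD x y : p (x + y) = p x + p y.
  apply/eqP; rewrite eq_le sp.1/= -[leRHS]opprK -pN opprD.
  by rewrite lerNr opprD -!pN sp.1.
have pZ (a : R) x : 0 <= a -> p (a *: x) = a * p x.
  by move=> a0; apply/eqP; rewrite eq_le sp.2//= sublinear_ray.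
move=> a x y; rewrite pD; congr (_ + _).
have [/pZ//|a0] := lerP 0 a.
by rewrite -[a]opprK scaleNr pN pZ ?oppr_ge0 ?ltW// scaleNr.
Qed.

(** Zorn's lemma applies because the pointwise infimum of a chain below [p] is
    bounded below by [x |-> - p (- x)] and is again sublinear: for subadditivity,
    two members of the chain can be replaced by the smaller one. *)
Lemma minimal_sublinear_exists p : sublinear p ->
  exists q, [/\ sublinear q, forall x, q x <= p x &
    forall r, sublinear r -> (forall x, r x <= q x) -> forall x, q x <= r x].
Proof.
move=> sp.
pose T := {q : V -> R | sublinear q /\ forall x, q x <= p x}.
pose below (q r : T) : bool := `[< forall x, sval r x <= sval q x >].
pose p' : T := exist _ p (conj sp (fun=> lexx _)).
have [||A Atot|[q [sq qp]] qmin] := @ZL_preorder T p' below.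
- by move=> q; exact/asboolP.
- move=> q r s /asboolP qr /asboolP rs; apply/asboolP => x.
  exact: le_trans (rs x) (qr x).
- have [[q0 Aq0]|A0] := pselect (A !=set0); last first.
    by exists p' => s As; case: A0; exists s.
  pose vals x := [set sval q x | q in A].
  have vals_inf x : has_inf (vals x).
    split; first by exists (sval q0 x), q0.
    exists (- p (- x)) => _ [q Aq <-]; have [sq qp] := svalP q.
    by rewrite (le_trans _ (sublinear_geN x sq))// lerN2.
  pose m x := inf (vals x).
  have mle (q : T) x : A q -> m x <= sval q x.
    by move=> Aq; apply: (ge_inf (vals_inf x).2); exists q.
  have m_ge (c : R) x : (forall q : T, A q -> c <= sval q x) -> c <= m x.
    move=> cq; apply: lb_le_inf; first exact: (vals_inf x).1.
    by move=> _ [q Aq <-]; exact: cq.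
  have sm : sublinear m.
    split.
      move=> x y; rewrite -lerBlDr; apply: (m_ge) => q Aq.
      rewrite lerBlDr -lerBlDl; apply: (m_ge) => r Ar; rewrite lerBlDl.
      have [/asboolP qr|/asboolP rq] := Atot q r Aq Ar.
        rewrite (le_trans (mle r _ Ar))// (le_trans ((svalP r).1.1 x y))//.
        by rewrite lerD2r.
      rewrite (le_trans (mle q _ Aq))// (le_trans ((svalP q).1.1 x y))//.
      by rewrite lerD2l.
    move=> a x; rewrite le_eqVlt => /predU1P[<-|a0].
      rewrite scale0r mul0r (le_trans (mle q0 _ Aq0))// sublinear0//.
      exact: (svalP q0).1.
    rewrite -ler_pdivrMl//; apply: (m_ge) => q Aq; rewrite ler_pdivrMl//.
    by rewrite (le_trans (mle q _ Aq))//; apply: (svalP q).1.2; exact: ltW.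
  have mp x : m x <= p x by exact: le_trans (mle q0 x Aq0) ((svalP q0).2 x).
  by exists (exist _ m (conj sm mp)) => q Aq; apply/asboolP => x; exact: mle.
- exists q; split=> // r sr rq.
  have rp x : r x <= p x by exact: le_trans (rq x) (qp x).
  by have /asboolP := qmin (exist _ r (conj sr rp)) (asboolT rq).
Qed.

(** Minimizing below the tilt of [p] at [v], instead of below [p] itself,
    forces the linear functional to touch [p] at [v]. This formulation needs no
    partially defined functionals. *)
Lemma hahn_banach p v : sublinear p ->
  exists f : V -> R^o, [/\ linear f, forall x, f x <= p x & f v = p v].
Proof.
move=> sp.
have [f [sf fq fmin]] := minimal_sublinear_exists (sublinear_tilt v sp).
have lf := minimal_sublinear_linear sf fmin.
have fp x : f x <= p x by exact: le_trans (fq x) (tilt_below v x sp).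
exists f; split=> //; apply/eqP; rewrite eq_le fp/= -lerN2.
have -> : - f v = f (- v).
  have := lf (-1) v 0; rewrite addr0 scaleN1r => ->.
  by rewrite sublinear0// addr0 scaleN1r.
exact: le_trans (fq _) (tiltN v sp).
Qed.

End sublinear_functionals.

(** * Functionals vanishing on a subspace, and separation *)

Section normed_functionals.
Context {R : realType} {V : normedModType R}.
Implicit Types (v w : V) (W : set V).

Lemma dist_le v w W : W w -> dist v W <= `|v - w|.
Proof.
move=> Ww; apply: ge_inf; last by exists w.
by exists 0 => _ [u _ <-].
Qed.

Lemma le_dist v W (m : R) :
  W !=set0 -> (forall w, W w -> m <= `|v - w|) -> m <= dist v W.
Proof.
move=> [w Ww] mW; apply: lb_le_inf; first by exists `|v - w|, w.
by move=> _ [u Wu <-]; exact: mW.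
Qed.

Lemma linear_subspaceN W w : linear_subspace W -> W w -> W (- w).
Proof. by move=> [W0 WL] Ww; rewrite -[- w]addr0 -scaleN1r; exact: WL. Qed.

Lemma dist_bj_orth v W :
  linear_subspace W -> bj_orth_set v W -> dist v W = `|v|.
Proof.
move=> sW vW; apply/eqP; rewrite eq_le; apply/andP; split.
  by have := dist_le v sW.1; rewrite subr0.
apply: le_dist; first by exists 0; exact: sW.1.
by move=> w Ww; have := vW w Ww (-1); rewrite scaleN1r.
Qed.

Lemma sublinear_dist W : linear_subspace W -> sublinear (fun x : V => dist x W).
Proof.
move=> sW; have W0 : W !=set0 by exists 0; exact: sW.1.
split.
  move=> x y; rewrite -lerBlDr; apply: le_dist => // w Ww.
  rewrite lerBlDr -lerBlDl; apply: le_dist => // z Wz; rewrite lerBlDl.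
  have Wwz : W (w + z) by rewrite -[w]scale1r; exact: sW.2.
  by rewrite (le_trans (dist_le _ Wwz))// opprD addrACA ler_normD.
move=> a x; rewrite le_eqVlt => /predU1P[<-|a0].
  by rewrite scale0r mul0r (le_trans (dist_le _ sW.1))// subr0 normr0.
rewrite -ler_pdivrMl//; apply: le_dist => // w Ww; rewrite ler_pdivrMl//.
have Waw : W (a *: w) by rewrite -[_ *: _]addr0; apply: sW.2 => //; exact: sW.1.
by rewrite (le_trans (dist_le _ Waw))// -scalerBr normrZ gtr0_norm.
Qed.

(** The dual description of Birkhoff-James orthogonality: orthogonality says
    that the sublinear functional [x |-> dist x W] takes the value [`|v|] at [v],
    and a linear functional below this distance has norm at most one and
    kills [W]. *)
Lemma bj_orth_functional v W : linear_subspace W -> bj_orth_set v W ->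
  exists f : dual V, [/\ annihilator W f, `|f| <= 1 & f v = `|v|].
Proof.
move=> sW vW; have [g [lg gd gv]] := hahn_banach v (sublinear_dist sW).
have gN x : g (- x) = - g x.
  have g0 : g 0 = 0 by have := lg (-1) 0 0; rewrite scaler0 addr0 scaleN1r addNr.
  by rewrite -[- x]addr0 -scaleN1r lg g0 addr0 scaleN1r.
have gle x : g x <= `|x|.
  by rewrite (le_trans (gd x))// (le_trans (dist_le _ sW.1))// subr0.
have gnorm x : `|g x| <= 1 * `|x|.
  by rewrite mul1r ler_norml gle lerNl -gN -normrN gle.
have bg : g \in bounded_linear V R^o by apply/asboolP; split=> //; exists 1.
exists (Bop bg); split => /=; last by rewrite gv dist_bj_orth.
  have gle0 w : W w -> g w <= 0.
    move=> Ww; rewrite (le_trans (gd w))// (le_trans (dist_le _ Ww))//.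
    by rewrite subrr normr0.
  move=> w Ww; apply/eqP; rewrite eq_le gle0//= -oppr_le0 -gN gle0//.
  exact: linear_subspaceN.
by apply: opnorm_le => // x; exact: gnorm.
Qed.

Lemma norming_functional v : exists f : dual V, `|f| <= 1 /\ f v = `|v|.
Proof.
have s0 : linear_subspace [set 0 : V].
  by split=> // a _ _ -> ->; rewrite scaler0 addr0.
have [|f [_ f1 fv]] := @bj_orth_functional v [set 0] s0; last by exists f.
by move=> _ -> a; rewrite scaler0 addr0.
Qed.

Lemma functional_neq0 v : v != 0 -> exists f : dual V, f v != 0.
Proof.
have [f [_ fv]] := norming_functional v.
by move=> v0; exists f; rewrite fv normr_eq0.
Qed.

Lemma functionals_separate v w : (forall f : dual V, f v = f w) -> v = w.
Proof.
move=> fE; apply/eqP; rewrite -subr_eq0; apply/negPn/negP => /functional_neq0[f].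
by rewrite linearB/= fE subrr eqxx.
Qed.

End normed_functionals.

(** * Biorthogonal functionals and operators of finite rank *)

Section biorthogonal_functionals.
Context {R : realType}.

Lemma scaled_bounded_linear (X Y : normedModType R) (f : dual X) (y : Y) :
  (fun x => (f x : R) *: y) \in bounded_linear X Y.
Proof.
apply/asboolP; split; first by move=> a u v; rewrite linearP scalerDl scalerA.
exists (`|f| * `|y|) => x; rewrite normrZ mulrAC ler_wpM2r//.
exact: bop_le_norm.
Qed.

Definition rank_one (X Y : normedModType R) (f : dual X) (y : Y) : bop X Y :=
  Bop (scaled_bounded_linear f y).

Lemma bop_sum (X Y : normedModType R) n (T : 'I_n -> bop X Y) x :
  (\sum_(i < n) T i) x = \sum_(i < n) T i x.
Proof. exact: (big_morph (fun S : bop X Y => S x)). Qed.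

(** By induction: functionals biorthogonal to all vectors but the last give a
    projection [P] onto their span; independence makes [x - P x] nonzero at the
    last vector, so some functional [g] separates it from zero, and a multiple
    of [g \o (id - P)] is the new functional. The others are then corrected by
    multiples of it. *)
Lemma biorthogonal_functionals (X : normedModType R) n (x : 'I_n -> X) :
  lin_indep x ->
  exists f : 'I_n -> dual X, forall i j, f i (x j) = (i == j)%:R.
Proof.
elim: n x => [|n IH] x ix; first by exists (fun=> 0) => -[].
pose x' i := x (lift ord_max i).
have [a a0|f fx] := IH x'.
  (* the relation [a] padded with a zero coefficient at the last vector *)
  pose b i := if unlift ord_max i is Some j then a j else 0.
  have bl j : b (lift ord_max j) = a j by rewrite /b liftK.
  move=> i; rewrite -bl; apply: ix; rewrite big_ord_recr/= /b unlift_none scale0r.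
  rewrite addr0 -[RHS]a0; apply: eq_bigr => j _.
  have -> : widen_ord (leqnSn n) j = lift ord_max j.
    by apply: val_inj; rewrite /= /bump leqNgt ltn_ord.
  by rewrite liftK.
pose P : bop X X := \sum_(i < n) rank_one (f i) (x' i).
have Px i : P (x' i) = x' i.
  rewrite bop_sum (bigD1 i)//= fx eqxx scale1r big1 ?addr0// => j ji.
  by rewrite fx (negbTE ji) scale0r.
pose w := x ord_max - P (x ord_max).
have w0 : w != 0.
  apply/eqP => w0.
  (* otherwise the last vector is a combination of the others *)
  pose b i : R := if unlift ord_max i is Some j then - f j (x ord_max) else 1.
  have : b ord_max = 0.
    apply: ix; rewrite big_ord_recr/= {2}/b unlift_none scale1r.
    rewrite -[RHS]w0 /w addrC; congr (_ + _); rewrite bop_sum -sumrN.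
    apply: eq_bigr => j _.
    have -> : widen_ord (leqnSn n) j = lift ord_max j.
      by apply: val_inj; rewrite /= /bump leqNgt ltn_ord.
    by rewrite /b liftK scaleNr.
  by rewrite /b unlift_none => /eqP; rewrite oner_eq0.
have [g gw] := functional_neq0 w0.
pose h : dual X := (g w)^-1 *: (g - bop_comp g P).
have hE z : h z = (g w)^-1 * (g z - g (P z)) by [].
have hx i : h (x' i) = 0 by rewrite hE Px subrr mulr0.
have hmax : h (x ord_max) = 1 by rewrite hE -linearB mulVf.
exists (fun i => if unlift ord_max i is Some j
                 then f j - (f j (x ord_max) : R) *: h else h) => i j.
case: (unliftP ord_max i) => [i'|] ->; case: (unliftP ord_max j) => [j'|] ->.
- by rewrite bopD -/(x' j') fx -scaleNr bopZ hx scaler0 addr0 (inj_eq lift_inj).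
- rewrite bopD -scaleNr bopZ hmax (eq_sym _ ord_max) (negbTE (neq_lift _ _)).
  by rewrite scaleNr -[_ *: 1]/(_ * 1) mulr1 subrr.
- by rewrite -/(x' j') hx (negbTE (neq_lift _ _)).
- by rewrite hmax eqxx.
Qed.

End biorthogonal_functionals.

(** * Weak compactness through ultrafilters *)

Lemma ultra_fmap (I J : Type) (h : I -> J) (U : set_system I) :
  UltraFilter U -> UltraFilter (h @ U).
Proof.
move=> UU; split=> [|G GF hUG]; first exact: fmap_proper_filter.
apply/seteqP; split; last exact: hUG.
move=> A GA; have [//|nA] := in_ultra_setVsetC (h @^-1` A) UU.
have GnA : G (~` A) by exact: hUG.
by have /filter_ex[? []] : G (A `&` ~` A) by exact: filterI.
Qed.

Lemma free_ultrafilter : exists U : set_system nat, UltraFilter U /\ \oo `<=` U.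
Proof. exact: ultraFilterLemma. Qed.

Section weak_limits.
Context {R : realType}.

Lemma bounded_ultra_cvg (I : Type) (U : set_system I) (h : I -> R) (M : R) :
  UltraFilter U -> U [set i | `|h i| <= M] -> exists l : R, h @ U --> l.
Proof.
move=> UU UM; have := @segment_compact R (- M) M; rewrite compact_ultra.
move=> /(_ _ (ultra_fmap h UU))[|l [_ hl]]; last by exists l.
by apply: (@filterS _ U _ _ _ _ UM) => i /=; rewrite in_itv /= -ler_norml.
Qed.

(** The Banach-Alaoglu theorem. Along an ultrafilter each bounded scalar family
    [phi i v] converges by itself, so that the weak-star limit is defined
    pointwise, and linearity and the norm bound pass to the limit. *)
Lemma alaoglu (V : normedModType R) (I : Type) (U : set_system I)
    (phi : I -> dual V) :
  UltraFilter U -> U [set i | `|phi i| <= 1] ->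
  exists f : dual V, `|f| <= 1 /\ forall v, phi i v @[i --> U] --> f v.
Proof.
move=> UU U1.
have phile v : U [set i | `|phi i v| <= `|v|].
  apply: filterS U1 => i /= i1; rewrite (le_trans (bop_le_norm _ _))//.
  by rewrite ler_piMl.
have /choice[f fE] v := bounded_ultra_cvg UU (phile v).
have UP : ProperFilter U by exact: ultra_proper.
have lf : linear (f : V -> R^o).
  move=> a u v; apply: (@cvg_unique _ (@Rhausdorff R) _ _ _ _ (fE _)).
  rewrite (_ : (fun i => _) = (fun i => a * phi i u + phi i v)); last first.
    by apply/funext => i; exact: linearP.
  by apply: cvgD => //; apply: cvgMl_tmp.
have fle v : `|f v| <= 1 * `|v|.
  rewrite mul1r; apply: (cvgr_to_le (cvg_norm (fE v))); exact: phile.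
have bf : (f : V -> R^o) \in bounded_linear V R^o.
  by apply/asboolP; split=> //; exists 1.
by exists (Bop bf); split=> //; apply: opnorm_le.
Qed.

Definition weakly_cvg (X : normedModType R) (F : set_system X) (x : X) : Prop :=
  forall f : dual X, f @ F --> f x.

(** Alaoglu's theorem in the bidual; reflexivity turns the limit functional
    into a point of [X]. *)
Lemma reflexive_ball_compact (X : normedModType R) (F : set_system X) :
  reflexive_space X -> UltraFilter F -> F (unit_ball X) ->
  exists2 x, unit_ball X x & weakly_cvg F x.
Proof.
move=> hX UF FB.
have Fphi : F [set x | `|bidual_emb X x| <= 1].
  apply: filterS FB => x /= x1; apply: opnorm_le => // f.
  by rewrite (le_trans (bop_le_norm f x))// mulrC ler_wpM2r.
have [Phi [Phi1 Phicvg]] := alaoglu UF Fphi.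
have : range (bidual_emb X) Phi by rewrite hX.
move=> [x _ PhiE]; exists x; last by move=> f; have := Phicvg f; rewrite -PhiE.
have [f [f1 fx]] := norming_functional x.
rewrite /unit_ball/= -fx -[f x]/(bidual_emb X x f) PhiE.
rewrite (le_trans (ler_norm _))// (le_trans (bop_le_norm _ _))//.
by rewrite mulr_ile1.
Qed.

(** Complete continuity, tested along ultrafilters on the unit ball. *)
Definition weak_to_norm_continuous (X Y : normedModType R)
    (T : bop X Y) : Prop :=
  forall (F : set_system X) (x : X), UltraFilter F -> F (unit_ball X) ->
    weakly_cvg F x -> T @ F --> T x.

(** Compactness gives a norm limit of the images along the ultrafilter, and
    functionals identify it with the image of the weak limit. *)
Lemma compact_weak_to_norm (X Y : normedModType R) (T : bop X Y) :
  compact_operator T -> weak_to_norm_continuous T.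
Proof.
rewrite /compact_operator precompactE compact_ultra => cT F x UF FB Fx.
have UP : ProperFilter F by exact: ultra_proper.
have [|y [_ Ty]] := cT _ (ultra_fmap T UF).
  by apply: (@filterS _ F _ _ _ _ FB) => u Bu; apply: subset_closure; exists u.
suff -> : T x = y by [].
apply: functionals_separate => g.
apply: (@cvg_unique _ (@Rhausdorff R) _ _ _ _ (Fx (bop_comp g T))).
by apply: cvg_comp Ty _; exact: bop_continuous.
Qed.

Lemma rank_one_weak_to_norm (X Y : normedModType R) (f : dual X) (y : Y) :
  weak_to_norm_continuous (rank_one f y).
Proof.
move=> F x UF _ Fx; have UP : ProperFilter F by exact: ultra_proper.
by apply: cvgZr_tmp; exact: Fx.
Qed.

Lemma sum_weak_to_norm (X Y : normedModType R) n (T : 'I_n -> bop X Y) :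
  (forall i, weak_to_norm_continuous (T i)) ->
  weak_to_norm_continuous (\sum_(i < n) T i).
Proof.
move=> cT; apply: big_ind => [|S S' cS cS'|//] F x UF FB Fx;
  have UP : ProperFilter F by exact: ultra_proper.
  exact: cvg_cst.
by apply: cvgD; [exact: cS|exact: cS'].
Qed.

End weak_limits.

(** * Extreme points of the ball of a reflexive space *)

Section weakly_closed_faces.
Context {R : realType} {X : normedModType R} (hX : reflexive_space X).
Implicit Types (A : set X) (f g : dual X).

(** Nonempty weakly closed extremal subsets of the unit ball. Weak closedness is
    expressed by limits of ultrafilters, the form in which compactness of the
    ball is available. *)
Definition weak_face A : Prop :=
  [/\ A !=set0, A `<=` unit_ball X,
      forall u v (t : R), unit_ball X u -> unit_ball X v -> 0 < t < 1 ->
        A (t *: u + (1 - t) *: v) -> A u /\ A v &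
      forall (F : set_system X) x,
        UltraFilter F -> F A -> weakly_cvg F x -> unit_ball X x -> A x].

Lemma weak_face_unit_ball : weak_face (unit_ball X).
Proof. by split=> //; exists 0; rewrite /unit_ball/= normr0. Qed.

Lemma weak_face_limit A (F : set_system X) :
  weak_face A -> UltraFilter F -> F A -> exists2 x, A x & weakly_cvg F x.
Proof.
move=> [_ AB _ cA] UF FA.
have [x Bx Fx] := reflexive_ball_compact hX UF (filterS AB FA).
by exists x => //; exact: cA FA Fx Bx.
Qed.

(** A maximizing sequence has a weak limit along a free ultrafilter. *)
Lemma weak_face_max A f : weak_face A ->
  exists2 a, A a & forall b, A b -> f b <= f a.
Proof.
move=> fA; have [[a0 Aa0] AB _ _] := fA.
pose E := [set (f a : R) | a in A].
have supE : has_sup E.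
  split; first by exists (f a0), a0.
  exists `|f| => _ [a /AB a1 <-]; rewrite (le_trans (ler_norm _))//.
  by rewrite (le_trans (bop_le_norm f a))// ler_piMr.
have /choice[a aE] k : exists a, A a /\ sup E - k.+1%:R^-1 < f a.
  have k0 : (0 : R) < k.+1%:R^-1 by rewrite invr_gt0 ltr0n.
  by have [_ [a Aa <-] lta] := sup_adherent k0 supE; exists a.
have [U [UU ooU]] := free_ultrafilter.
have UA : (a @ U) A by apply: (@filterE _ U) => k; exact: (aE k).1.
have [x Ax ax] := weak_face_limit fA (ultra_fmap a UU) UA.
exists x => // b Ab.
suff -> : f x = sup E by apply: (sup_upper_bound supE); exists b.
apply: (@cvg_unique _ (@Rhausdorff R) _ _ _ _ (ax f)).
have UP : ProperFilter U by exact: ultra_proper.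
apply: (@squeeze_cvgr _ _ _ _ (fun k => sup E - k.+1%:R^-1) (cst (sup E))).
- near=> k; rewrite ltW ?(aE k).2//=.
  by apply: (sup_upper_bound supE); exists (a k) => //; exact: (aE k).1.
- rewrite -[X in _ --> X]subr0; apply: cvgB; first exact: cvg_cst.
  by apply: cvg_trans (@cvg_harmonic R); exact: cvg_app.
- exact: cvg_cst.
Unshelve. all: by end_near. Qed.

(** If an interior point of a segment maximizes [f] over [A], both ends, which
    lie in [A], do so too, as [f] is affine along the segment. *)
Lemma weak_face_argmax A f : weak_face A ->
  weak_face [set a | A a /\ forall b, A b -> f b <= f a].
Proof.
move=> fA; have [_ AB Aface Acl] := fA; split.
- by have [a Aa am] := weak_face_max f fA; exists a.
- by move=> a [/AB].
- move=> u v t Bu Bv t01 [Auv m].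
  have [Au Av] := Aface u v t Bu Bv t01 Auv.
  have /andP[t0 t1] := t01; have s0 : 0 < 1 - t by rewrite subr_gt0.
  have mu := m u Au; have mv := m v Av.
  have fE : f (t *: u + (1 - t) *: v) = t * f u + (1 - t) * f v.
    by rewrite linearD !linearZ.
  have uv : f u = f v.
    apply/eqP; rewrite eq_le; apply/andP; split.
      by rewrite -(ler_pM2l s0); move: mu; rewrite fE; lra.
    by rewrite -(ler_pM2l t0); move: mv; rewrite fE; lra.
  have fu : f (t *: u + (1 - t) *: v) = f u by rewrite fE -uv; lra.
  by split; split=> // b Ab; rewrite -?uv -fu; exact: m.
- move=> F x UF FA Fx Bx.
  have UP : ProperFilter F by exact: ultra_proper.
  split; first by apply: (Acl F) => //; apply: filterS FA => y [].
  move=> b Ab; apply: (cvgr_to_ge (Fx f)).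
  by apply: filterS FA => y [_]; exact.
Qed.

(** Zorn's lemma: a chain of weak faces has a nonempty intersection because an
    ultrafilter containing all of its members has a weak limit, which lies in
    each of them. *)
Lemma weak_face_minimal A : weak_face A ->
  exists B, [/\ weak_face B, B `<=` A &
    forall C, weak_face C -> C `<=` B -> B `<=` C].
Proof.
move=> fA.
pose T := {B : set X | weak_face B /\ B `<=` A}.
pose A' : T := exist _ A (conj fA (@subset_refl _ A)).
pose below (B C : T) : bool := `[< sval C `<=` sval B >].
have [||S Stot|[B [fB BA]] Bmin] := @ZL_preorder T A' below.
- by move=> B; exact/asboolP.
- move=> B C D /asboolP CB /asboolP DC; apply/asboolP.
  exact: subset_trans DC CB.
- have [[B0 SB0]|S0] := pselect (S !=set0); last first.
    by exists A' => B SB; case: S0; exists B.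
  have [[x0 B0x0] B0B _ _] := (svalP B0).1.
  have FF : ProperFilter (filter_from S (fun B => sval B)).
    apply: filter_from_proper; last by move=> B _; case: (svalP B).1.
    apply: filter_from_filter; first by exists B0.
    move=> B C SB SC; have [/asboolP CB|/asboolP BC] := Stot B C SB SC.
      by exists C => // x Cx; split=> //; exact: CB.
    by exists B => // x Bx; split=> //; exact: BC.
  have [U [UU FU]] := ultraFilterLemma FF.
  have US (B : T) : S B -> U (sval B) by move=> SB; apply: FU; exists B.
  have [x B0x Ux] := weak_face_limit (svalP B0).1 UU (US B0 SB0).
  pose K := \bigcap_(B in S) sval B.
  have fK : weak_face K.
    split.
    - exists x => B SB; have [_ _ _ Bcl] := (svalP B).1.
      by apply: (Bcl U) => //; [exact: US|exact: B0B].
    - by move=> y /(_ B0 SB0)/B0B.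
    - move=> u v t Bu Bv t01 Kuv; split=> B SB; have [_ _ Bf _] := (svalP B).1;
        by have [] := Bf u v t Bu Bv t01 (Kuv B SB).
    - move=> F y UF FK Fy By B SB; have [_ _ _ Bcl] := (svalP B).1.
      by apply: (Bcl F) => //; apply: filterS FK => z; exact.
  have KA : K `<=` A by move=> y /(_ B0 SB0); exact: (svalP B0).2.
  by exists (exist _ K (conj fK KA)) => B SB; apply/asboolP => y; exact.
- exists B; split=> // C fC CB.
  have CA : C `<=` A by exact: subset_trans CB BA.
  by have /asboolP := Bmin (exist _ C (conj fC CA)) (asboolT CB).
Qed.

(** Existence part of the Krein-Milman theorem: every functional is constant on
    a minimal weak face, by the lemma on maximizers, so that the face is a single
    point; a one-point face is an extreme point. *)
Lemma weak_face_extreme_point A : weak_face A ->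
  exists2 e, A e & extreme_points (unit_ball X) e.
Proof.
move=> /weak_face_minimal[B [fB BA Bmin]].
have [[e Be] BB Bface _] := fB.
have B1 u : B u -> u = e.
  move=> Bu; apply: functionals_separate => f; apply/eqP; rewrite eq_le.
  have Bmax := Bmin _ (weak_face_argmax f fB) (fun _ => @proj1 _ _).
  by rewrite (Bmax e Be).2// (Bmax u Bu).2.
exists e; first exact: BA.
split=> [|u v t Bu Bv t01 eE]; first exact: BB.
have [/B1 ue /B1 ve] : B u /\ B v by apply: (Bface u v t); rewrite -?eE.
by [].
Qed.

(** Used with [f = g0 \o T] and [g = g0 \o S] for a functional [g0]: among the
    extreme points at which [f] is maximal there is one where [g] is at least as
    large as at any given maximizer of [f]. It replaces the representation of
    this maximizer as a barycenter of extreme points. *)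
Lemma lexicographic_extreme_max f g u : unit_ball X u ->
  (forall v, unit_ball X v -> f v <= f u) ->
  exists e, [/\ extreme_points (unit_ball X) e, f e = f u & g u <= g e].
Proof.
move=> Bu fmax.
have [e [[Be emax] egmax] ee] := weak_face_extreme_point
  (weak_face_argmax g (weak_face_argmax f weak_face_unit_ball)).
exists e; split=> //; last exact: egmax.
by apply/eqP; rewrite eq_le fmax// emax.
Qed.

End weakly_closed_faces.

(** * Orthogonality of operators *)

Section orthogonality.
Context {R : realType} {X Y : normedModType R}.

(** The point [u] is a weak limit, and [g] a weak-star limit, of approximate
    norming pairs [(u k, g k)] of [T + e k *: S], where [e k] tends to zero: as
    [T + e k *: S] has norm at least [`|T|] while [g k (T (u k))] never exceeds
    [`|T|], the number [g k (S (u k))] is asymptotically nonnegative. *)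
Lemma bj_orth_norming_pair (T S : bop X Y) : reflexive_space X ->
  weak_to_norm_continuous T -> weak_to_norm_continuous S -> bj_orth T S ->
  exists (u : X) (g : dual Y),
    [/\ unit_ball X u, `|g| <= 1, g (T u) = `|T| & 0 <= g (S u)].
Proof.
move=> hX cT cS TS.
pose e k : R := k.+1%:R^-1.
have e0 k : 0 < e k by rewrite invr_gt0 ltr0n.
(* The error is of second order in [e k], so that it still vanishes after the
   division by [e k] which isolates [g k (S (u k))]. *)
have /choice[u uE] k : exists u, unit_ball X u /\
    `|T| - e k ^+ 2 < `|(T + e k *: S) u|.
  have [_ [u Bu <-] ltu] :=
    sup_adherent (exprn_gt0 2 (e0 k)) (opnorm_has_sup (T + e k *: S)).
  exists u; split=> //; apply: le_lt_trans ltu.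
  by rewrite lerD2r; exact: TS.
have /choice[g gE] k := norming_functional ((T + e k *: S) (u k)).
have [U [UU ooU]] := free_ultrafilter.
have UP : ProperFilter U by exact: ultra_proper.
have Ug : U [set k | `|g k| <= 1] by apply: filterE => k; exact: (gE k).1.
have [f [f1 fE]] := alaoglu UU Ug.
have Uu : (u @ U) (unit_ball X) by apply: (@filterE _ U) => k; exact: (uE k).1.
have [x Bx ux] := reflexive_ball_compact hX (ultra_fmap u UU) Uu.
have e_cvg : e @ U --> (0 : R).
  by apply: cvg_trans (@cvg_harmonic R); exact: cvg_app.
(* Norm convergence of [Q (u k)] allows both arguments to move at once. *)
have lim (Q : bop X Y) : weak_to_norm_continuous Q ->
    (g k (Q (u k)) : R) @[k --> U] --> (f (Q x) : R).
  move=> cQ; have Qu : Q (u k) @[k --> U] --> Q x.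
    exact: (cQ _ _ (ultra_fmap u UU) Uu ux).
  rewrite -[X in _ --> X]add0r.
  rewrite (_ : (fun k => _) =
      (fun k => (g k (Q (u k) - Q x) : R) + (g k (Q x) : R))); last first.
    by apply/funext => k; rewrite linearB subrK.
  apply: cvgD; last exact: fE.
  apply: norm_cvg0.
  apply: (@squeeze_cvgr _ _ _ _ (cst 0) (fun k => `|Q (u k) - Q x|)).
  - near=> k; rewrite normr_ge0/= (le_trans (bop_le_norm _ _))//.
    by rewrite ler_piMl// (gE k).1.
  - exact: cvg_cst.
  - rewrite -(normr0 Y) -(subrr (Q x)); apply: cvg_norm.
    by apply: cvgB => //; exact: cvg_cst.
have gT k : g k (T (u k)) <= `|T|.
  rewrite (le_trans (ler_norm _))// (le_trans (bop_le_norm _ _))//.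
  rewrite (le_trans (ler_wpM2r _ (gE k).1))// mul1r.
  by rewrite (le_trans (bop_le_norm _ _))// ler_piMr//; exact: (uE k).1.
have sum_lt k : `|T| - e k ^+ 2 < g k (T (u k)) + e k * g k (S (u k)).
  have := (uE k).2; rewrite -(gE k).2 bopD bopZ linearD.
  by rewrite (linearZ_LR (g k)).
exists x, f; split=> //.
- apply/eqP; rewrite eq_le; apply/andP; split.
    by apply: (cvgr_to_le (lim T cT)); apply: filterE.
  have : (g k (T (u k)) + e k * g k (S (u k)) + e k ^+ 2) @[k --> U] -->
      (f (T x) + 0 * f (S x) + 0 * 0 : R).
    apply: cvgD; last exact: cvgM.
    by apply: cvgD; [exact: lim|apply: cvgM => //; exact: lim].
  rewrite !mul0r !addr0 => /cvgr_to_ge; apply.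
  by apply: filterE => k; rewrite -lerBlDr ltW.
- have : (g k (S (u k)) + e k) @[k --> U] --> (f (S x) + 0 : R).
    by apply: cvgD => //; exact: lim.
  rewrite addr0 => /cvgr_to_ge; apply.
  apply: filterE => k; rewrite -(pmulr_rge0 _ (e0 k)) mulrDr -expr2.
  by have := sum_lt k; have := gT k; lra.
Unshelve. all: by end_near. Qed.

End orthogonality.

Section orthogonality_at_extreme_points.
Context {R : realType} {X Y : normedModType R}.

(** If no [T (x i)] were orthogonal to [Z], some [z i] in [Z] would satisfy
    [`|T (x i) + z i| < `|T|] for each [i]. Linear independence provides an
    operator [S] of finite rank into [Z] with [S (x i) = z i]. Orthogonality of
    [T] to [S] yields a norming functional [g] and, by lexicographic
    maximization, an extreme norm-attaining point [e] with [g (T e) = `|T|] and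
    [0 <= g (S e)]; but [e] is one of the points [x i], [- x i]. *)
Lemma bj_orth_at_extreme_point (Z : set Y) (T : bop X Y) n (x : 'I_n -> X) :
  reflexive_space X -> linear_subspace Z -> compact_operator T -> T <> 0 ->
  norm_attainment T `&` extreme_points (unit_ball X) =
    [set y | exists i, y = x i \/ y = - x i] ->
  lin_indep x -> bj_orth_set T (ops_into Z) ->
  exists i, bj_orth_set (T (x i)) Z.
Proof.
move=> hX sZ cT T0 MTE ix TZ.
have Tx i : `|T (x i)| = `|T|.
  suff [[_ ->]] :
    (norm_attainment T `&` extreme_points (unit_ball X)) (x i) by [].
  by rewrite MTE; exists i; left.
apply: contrapT => noi.
(* The scalar of a failing orthogonality inequality is absorbed into [z]. *)
have /choice[z zE] i : exists z, Z z /\ `|T (x i) + z| < `|T|.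
  apply: contrapT => noz; apply: noi; exists i => z Zz a.
  rewrite Tx leNgt; apply/negP => lt_a; apply: noz; exists (a *: z).
  by split=> //; rewrite -[_ *: _]addr0; apply: sZ.2 => //; exact: sZ.1.
have [f fx] := biorthogonal_functionals ix.
pose S : bop X Y := \sum_(i < n) rank_one (f i) (z i).
have Sx i : S (x i) = z i.
  rewrite bop_sum (bigD1 i)//= fx eqxx scale1r big1 ?addr0// => j ji.
  by rewrite fx (negbTE ji) scale0r.
have ZS : ops_into Z S.
  move=> y; rewrite bop_sum; apply: (big_ind Z) => [|u v Zu Zv|i _].
  - exact: sZ.1.
  - by rewrite -[u]scale1r; exact: sZ.2.
  - by rewrite -[rank_one _ _ _]addr0; apply: sZ.2; [exact: (zE i).1|exact: sZ.1].
have [u [g [Bu g1 gTu gSu]]] := bj_orth_norming_pair hX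
  (compact_weak_to_norm cT)
  (sum_weak_to_norm (fun i => @rank_one_weak_to_norm R X Y (f i) (z i)))
  (TZ S ZS).
have gle w : g w <= `|w|.
  by rewrite (le_trans (ler_norm _))// (le_trans (bop_le_norm _ _))// ler_piMl.
have [|e [Ee gTe gSe]] :=
    @lexicographic_extreme_max _ _ hX (bop_comp g T) (bop_comp g S) u Bu.
  move=> v Bv; rewrite /= gTu (le_trans (gle _))//.
  by rewrite (le_trans (bop_le_norm _ _))// ler_piMr.
have {}gTe : g (T e) = `|T| by rewrite -gTu.
have {gSu}gSe : 0 <= g (S e) by exact: le_trans gSu gSe.
have Tpos : 0 < `|T| by rewrite normr_gt0; exact/eqP.
have Te_le := bop_le_norm T e.
have Te_ge : `|T| <= `|T e| by rewrite -gTe.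
have e1 : `|e| = 1.
  apply/eqP; rewrite eq_le Ee.1/= -(ler_pM2l Tpos) mulr1.
  exact: le_trans Te_ge Te_le.
have : (norm_attainment T `&` extreme_points (unit_ball X)) e.
  split=> //; split=> //; apply/eqP; rewrite eq_le Te_ge andbT.
  by move: Te_le; rewrite e1 mulr1.
rewrite MTE => -[i eE].
have : `|T| <= `|T e + S e| by rewrite (le_trans _ (gle _))// linearD/= gTe lerDl.
rewrite leNgt => /negP; apply.
have [_] := zE i; case: eE => ->; first by rewrite Sx.
by rewrite !linearN/= -opprD normrN Sx.
Qed.

End orthogonality_at_extreme_points.

(** * Distance to the operators into a subspace *)

Theorem theorem2p9 (R : realType) (X Y : completeNormedModType R)
    (hX : reflexive_space X)
    (Z : set Y) (hZ : linear_subspace Z) (cZ : closed Z)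
    (T : bop X Y) (cT : compact_operator T)
    (msT : multi_smooth_finite_order T)
    (n : nat) (x : 'I_n -> X) (Sx : forall i, unit_sphere X (x i))
    (MTE : norm_attainment T `&` extreme_points (unit_ball X) =
           [set y | exists i, y = x i \/ y = - x i])
    (hx : lin_indep x)
    (TZ : bj_orth_set T (ops_into Z)) :
  exists x0 : X,
    (norm_attainment T `&` extreme_points (unit_ball X)) x0 /\
    (dist T (ops_into Z) = sup [set dist (T y) Z | y in unit_sphere X] /\
     sup [set dist (T y) Z | y in unit_sphere X] = dist (T x0) Z) /\
    bj_orth_set (bidual_emb Y (T x0)) (annihilator (annihilator Z)) /\
    bj_orth_set (bop_comp (bidual_emb Y) T)
      (ops_into (annihilator (annihilator Z))).
Proof.
have [i xiZ] := bj_orth_at_extreme_point hX hZ cT msT.1 MTE hx TZ.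
have Exi : (norm_attainment T `&` extreme_points (unit_ball X)) (x i).
  by rewrite MTE; exists i; left.
have [[x1 Txi] _] := Exi.
have ops_sub : linear_subspace (ops_into Z : set (bop X Y)).
  split=> [y|a A B ZA ZB y]; first exact: hZ.1.
  by rewrite bopD bopZ; exact: hZ.2.
have dT : dist T (ops_into Z) = `|T| by exact: dist_bj_orth.
have dTx : dist (T (x i)) Z = `|T| by rewrite dist_bj_orth.
have dle y : unit_sphere X y -> dist (T y) Z <= `|T|.
  move=> y1; rewrite (le_trans (dist_le _ hZ.1))// subr0.
  by rewrite (le_trans (bop_le_norm _ _))// y1 mulr1.
have supE : sup [set dist (T y) Z | y in unit_sphere X] = `|T|.
  apply/eqP; rewrite eq_le; apply/andP; split.
    apply: ge_sup; first by exists (dist (T (x i)) Z), (x i).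
    by move=> _ [y /dle ? <-].
  rewrite -dTx; apply: ub_le_sup; last by exists (x i).
  by exists `|T| => _ [y /dle ? <-].
have [g [gZ g1 gTx]] := bj_orth_functional hZ xiZ.
have eval_le (G : bidual Y) : `|G g| <= `|G|.
  by rewrite (le_trans (bop_le_norm _ _))// ler_piMr.
have emb_le y : `|bidual_emb Y y| <= `|y|.
  by apply: opnorm_le => // f; rewrite [leRHS]mulrC; exact: (bop_le_norm f y).
(* An element [G] of the second annihilator vanishes at [g], so that evaluation
   at [g] bounds the norm from below by [g (T (x i))]. *)
have key (G : bidual Y) a : annihilator (annihilator Z) G ->
    `|T| <= `|bidual_emb Y (T (x i)) + a *: G|.
  move=> ZG; rewrite (le_trans _ (eval_le _))// bopD bopZ (ZG g gZ) scaler0 addr0.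
  by rewrite -[bidual_emb Y _ g]/(g (T (x i))) gTx normr_id Txi.
exists (x i); split=> //; split; [by rewrite dT supE dTx|split].
- by move=> G ZG a; rewrite (le_trans (emb_le _))// Txi; exact: key.
- move=> S ZS a; apply: (@le_trans _ _ `|T|).
    apply: opnorm_le => // y; rewrite (le_trans (emb_le _))//.
    exact: bop_le_norm.
  rewrite (le_trans (key _ a (ZS (x i))))//.
  have := bop_le_norm (bop_comp (bidual_emb Y) T + a *: S) (x i).
  by rewrite x1 mulr1.
Qed.
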